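(* Let $m,n\ge1$ be integers and let $K_{m,n}$ be the complete bipartite graph with parts of sizes $m$ and $n$. Then $$X_{K_{m,n}}^2=\sum_{\alpha\models m+n}\frac{m!\,n!}{\alpha!}\,r(\alpha;m,n)\,M_\alpha,$$ where the sum is over all compositions $\alpha$ of $m+n$ and, for $\alpha=(\alpha_1,\dots,\alpha_{\ell(\alpha)})$ with $\ell(\alpha)$ parts, $$r(\alpha;m,n)=\Big|\Big\{(i,j) : 1<i\le j\le\ell(\alpha)\ \text{and}\ \sum_{t=i}^{j}\alpha_t=m\text{ or }n\Big\}\Big|$$ and $$\alpha!=\alpha_1!\,\alpha_2!\cdots\alpha_{\ell(\alpha)}!.$$
   Context: $\mathbb{P}$ denotes the positive integers. An orientation of a simple graph $G$ is a directed graph on the same vertices containing, for each edge $\{i,j\}$ of $G$, exactly one of $(i,j)$, $(j,i)$ (and no other edges). For $k\ge1$, an orientation $\mathcal{O}$ of $G$ is $k$-balanced if for every cycle of $G$ with edges $\{v_1,v_2\},\{v_2,v_3\},\dots,\{v_{r-1},v_r\},\{v_r,v_1\}$, $\mathcal{O}$ contains at least $k$ directed edges of the form $(v_i,v_{i+1})$ and at least $k$ directed edges of the form $(v_{i+1},v_i)$ (subscripts modulo $r$). A proper coloring of $G$ is a map $\kappa:V(G)\to\mathbb{P}$ with $\kappa(i)\ne\kappa(j)$ whenever $\{i,j\}$ is an edge. The orientation $\mathcal{O}_\kappa$ induced by a proper coloring $\kappa$ directs each edge toward the endpoint with the greater color; $\kappa$ is a $k$-balanced coloring if $\mathcal{O}_\kappa$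 is $k$-balanced. For a finite simple graph $G$ with $V(G)=\{1,\dots,N\}$, the $k$-balanced chromatic quasisymmetric function of $G$ is $$X_G^k=\sum_{\kappa}x_{\kappa(1)}x_{\kappa(2)}\cdots x_{\kappa(N)},$$ summed over all $k$-balanced colorings $\kappa:V(G)\to\mathbb{P}$, in commuting indeterminates $x_1,x_2,\dots$. A composition of $N$ (written $\alpha\models N$) is an ordered list $\alpha=(\alpha_1,\dots,\alpha_\ell)$ of positive integers with sum $N$; its length is $\ell(\alpha)=\ell$. The monomial quasisymmetric function is $M_\alpha=\sum_{i_1<i_2<\cdots<i_\ell}x_{i_1}^{\alpha_1}x_{i_2}^{\alpha_2}\cdots x_{i_\ell}^{\alpha_\ell}$.
   Formalization: In r(α;m,n), pairs (i,j) with block sum m and pairs with block sum n are counted separately and added; for m≠n this is the stated cardinality, for m=n it is twice it, since the literal formula fails there (m=n=1 gives M_(1,1) instead of 2M_(1,1)). *)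

(* Defs.v *)
From HB Require Import structures.
From mathcomp Require Import all_boot all_order all_algebra finmap.
From mathcomp Require Import boolp classical_sets functions cardinality fsbigop.
From mathcomp.multinomials Require Import monalg.

Set Implicit Arguments.
Unset Strict Implicit.
Unset Printing Implicit Defensive.

Import GRing.Theory Num.Theory.

Local Open Scope classical_set_scope.
Local Open Scope ring_scope.

Definition posint : Type := {c : nat | (0 < c)%N}.
HB.instance Definition _ := Countable.copy posint {c : nat | (0 < c)%N}.

Definition posint_lt : rel posint := fun c d => (val c < val d)%N.

Definition monomial : Type := {cmonom posint}.
HB.instance Definition _ := ConomialDef.copy monomial {cmonom posint}.

(** Every function from monomials to coefficients is a formal power series.
    The module structure is the pointwise one. *)
Definition fps : Type := monomial -> rat^o.
HB.instance Definition _ := GRing.Lmodule.copy fps (monomial -> rat^o).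

Definition xvar (c : posint) : monomial := ucm c.

Definition fps_monomial (u : monomial) : fps := fun w => (w == u)%:R.

(** Possibly infinite sums of series are taken coefficientwise. Since
    [\sum_(i \in A)] is 0 by convention when the support is infinite, such a sum
    is meaningful for a summable family only; see [summable_chromatic] and
    [summable_monomial_qsym]. *)
Definition summable (I : choiceType) (A : set I) (F : I -> fps) : Prop :=
  forall w : monomial, finite_set (A `&` [set i | F i w != 0]).

Definition fps_sum (I : choiceType) (A : set I) (F : I -> fps) : fps :=
  fun w => \sum_(i \in A) F i w.

Record sgraph (V : finType) := SGraph {
  adj :> rel V;
  adj_sym : symmetric adj;
  adj_irrefl : irreflexive adj }.

Section Graphs.
Variables (V : finType) (G : sgraph V).

Definition orientation (o : rel V) : Prop :=
  forall u v, (o u v -> G u v) /\ (G u v -> o u v (+) o v u).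

(** [v1; ...; vr] stands for the cycle with edges {v1,v2}, ..., {vr,v1}. *)
Definition is_cycle (c : seq V) : bool :=
  [&& (2 < size c)%N, cycle G c & uniq c].

Definition forward_edges (o : rel V) (c : seq V) : nat :=
  count (fun v => o v (next c v)) c.

Definition backward_edges (o : rel V) (c : seq V) : nat :=
  count (fun v => o (next c v) v) c.

Definition balanced (k : nat) (o : rel V) : Prop :=
  orientation o /\
  forall c, is_cycle c ->
    (k <= forward_edges o c)%N /\ (k <= backward_edges o c)%N.

Definition proper_coloring (kappa : {ffun V -> posint}) : Prop :=
  forall u v, G u v -> kappa u != kappa v.

Definition induced_orientation (kappa : {ffun V -> posint}) : rel V :=
  fun u v => G u v && posint_lt (kappa u) (kappa v).

Definition balanced_coloring (k : nat) (kappa : {ffun V -> posint}) : Prop :=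
  proper_coloring kappa /\ balanced k (induced_orientation kappa).

Definition coloring_monomial (kappa : {ffun V -> posint}) : monomial :=
  \big[mmul/mone]_(v : V) xvar (kappa v).

Definition chromatic_qsym (k : nat) : fps :=
  fps_sum [set kappa | balanced_coloring k kappa]
          (fun kappa => fps_monomial (coloring_monomial kappa)).

Lemma induced_orientationP (kappa : {ffun V -> posint}) :
  proper_coloring kappa -> orientation (induced_orientation kappa).
Proof.
move=> kP u v; split=> [/andP[]//|Guv].
rewrite /induced_orientation (adj_sym G v u) Guv /posint_lt /=.
by have := kP _ _ Guv; rewrite -val_eqE /=; case: ltngtP.
Qed.

End Graphs.

Definition bipartite_adj (m n : nat) : rel ('I_m + 'I_n) := fun u v =>
  match u, v with
  | inl _, inr _ | inr _, inl _ => true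
  | _, _ => false
  end.

Lemma bipartite_adj_sym m n : symmetric (@bipartite_adj m n).
Proof. by move=> [i|i] [j|j]. Qed.

Lemma bipartite_adj_irrefl m n : irreflexive (@bipartite_adj m n).
Proof. by move=> [i|i]. Qed.

Definition complete_bipartite (m n : nat) : sgraph ('I_m + 'I_n)%type :=
  SGraph (@bipartite_adj_sym m n) (@bipartite_adj_irrefl m n).

Definition composition (N : nat) : set (seq nat) :=
  [set alpha | all (fun a => 0 < a)%N alpha && (sumn alpha == N)].
Arguments composition : clear implicits.

Definition comp_fact (alpha : seq nat) : nat := (\prod_(a <- alpha) a`!)%N.

Definition increasing_indices (l : nat) : set (l.-tuple posint) :=
  [set i | sorted posint_lt i].
Arguments increasing_indices : clear implicits.

Definition index_monomial (alpha : seq nat) (i : (size alpha).-tuple posint) :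
    monomial :=
  \big[mmul/mone]_(t < size alpha) expcmn (xvar (tnth i t)) (nth 0%N alpha t).

Definition monomial_qsym (alpha : seq nat) : fps :=
  fps_sum (increasing_indices (size alpha))
          (fun i => fps_monomial (index_monomial i)).

(** alpha_i + ... + alpha_j, with parts numbered from 1 as on paper. *)
Definition part_sum (alpha : seq nat) (i j : nat) : nat :=
  (\sum_(i <= t < j.+1) nth 0 alpha t.-1)%N.

Definition block_count (alpha : seq nat) (P : pred nat) : nat :=
  #|[pred p : 'I_(size alpha).+1 * 'I_(size alpha).+1 |
      (1 < p.1 <= p.2)%N && P (part_sum alpha p.1 p.2)]|.

(** The pairs (i,j) with 1 < i <= j <= l(alpha) whose block sums to "m or n" are
    counted once for each of the two alternatives that they satisfy, i.e. once
    for each part of K_{m,n} that the colors i, ..., j can occupy. This matters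
    for m = n only ([r_neq], [r_diag]). There counting such a pair once would
    give half of the true coefficients: K_{1,1} has two colorings with color
    set {1,2}, but alpha = (1,1) has just the one pair (2,2). *)
Definition r (alpha : seq nat) (m n : nat) : nat :=
  (block_count alpha (pred1 m) + block_count alpha (pred1 n))%N.

Lemma r_neq alpha m n : m != n ->
  r alpha m n = block_count alpha (fun s => (s == m) || (s == n)).
Proof.
move=> mn; rewrite /r /block_count -cardUI [X in (_ + X)%N]eq_card0 ?addn0.
  by apply: eq_card => p; rewrite !inE -andb_orr.
move=> p; rewrite !inE /=; apply: contraNF mn.
by move=> /andP[/andP[_ /eqP<-] /andP[_]].
Qed.

Lemma r_diag alpha m :
  r alpha m m = (2 * block_count alpha (fun s => (s == m) || (s == m)))%N.
Proof.
rewrite /r mul2n addnn; congr (_.*2).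
by apply: eq_card => p; rewrite !inE orbb.
Qed.

Lemma finite_composition N : finite_set (composition N).
Proof.
have leq_size a : all (fun b => 0 < b)%N a -> (size a <= sumn a)%N.
  by elim: a => //= b a IH /andP[b0 /IH]; rewrite -addn1 addnC; exact: leq_add.
have leq_part a b : b \in a -> (b <= sumn a)%N.
  elim: a => //= c a IH; rewrite inE => /orP[/eqP->|/IH ba].
    exact: leq_addr.
  exact: leq_trans ba (leq_addl _ _).
pose f (t : N.-bseq 'I_N.+1) : seq nat := [seq val i | i <- t].
apply: (sub_finite_set (B := range f)); last exact: finite_image.
move=> a /= /andP[/leq_size sa /eqP aN]; rewrite aN in sa.
have sA : (size [seq inord b : 'I_N.+1 | b <- a] <= N)%N by rewrite size_map.
exists (Bseq sA) => //; rewrite /f /= -map_comp -[RHS]map_id.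
by apply/eq_in_map => b /leq_part ba /=; rewrite inordK// ltnS -aN.
Qed.

Lemma coloring_monomial_gt0 (V : finType) (kappa : {ffun V -> posint}) v :
  (0 < coloring_monomial kappa (kappa v))%N.
Proof.
by rewrite /coloring_monomial (bigD1 v)//= cmM cmUU.
Qed.

Lemma finite_ffun_on (aT : finType) (rT : choiceType) (B : {fset rT}) :
  finite_set [set f : {ffun aT -> rT} | forall x, f x \in B].
Proof.
pose g (h : {ffun aT -> B}) : {ffun aT -> rT} := [ffun x => val (h x)].
apply: (sub_finite_set (B := range g)); last exact: finite_image.
move=> f /= fB; exists [ffun x => [` fB x]%fset] => //.
by apply/ffunP => x; rewrite !ffunE.
Qed.

Lemma summable_chromatic (V : finType) (G : sgraph V) k :
  summable [set kappa | balanced_coloring G k kappa]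
           (fun kappa => fps_monomial (coloring_monomial kappa)).
Proof.
move=> w; apply: sub_finite_set (finite_ffun_on V (finsupp w)).
move=> kappa [_]; rewrite /= /fps_monomial pnatr_eq0 eqb0 negbK => /eqP-> v.
by rewrite -cmE_neq0 -lt0n coloring_monomial_gt0.
Qed.

Lemma summable_monomial_qsym N alpha : composition N alpha ->
  summable (increasing_indices (size alpha))
           (fun i => fps_monomial (index_monomial i)).
Proof.
move=> /andP[/all_nthP alpha0 _] w.
pose f (h : {ffun 'I_(size alpha) -> posint}) : (size alpha).-tuple posint :=
  [tuple h t | t < size alpha].
have fin_im : finite_set
    (f @` [set h : {ffun _ -> _} | forall t, h t \in finsupp w]).
  exact/finite_image/finite_ffun_on.
apply: sub_finite_set fin_im.
  move=> i [_]; rewrite /= /fps_monomial pnatr_eq0 eqb0 negbK => /eqP->.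
  exists [ffun t => tnth i t]; last first.
    by apply: eq_from_tnth => t; rewrite tnth_mktuple ffunE.
  move=> t; rewrite ffunE -cmE_neq0 -lt0n /index_monomial (bigD1 t)//= cmM.
  case E: (nth 0%N alpha t) (alpha0 0%N t (ltn_ord t)) => [//|[|a]] _.
    by rewrite /expcmn /= (cmUU (tnth i t)).
  by rewrite /expcmn /= mulcmE (cmUU (tnth i t)).
Qed.

(* Main.v *)
(** Write A and B for the two parts and read off the colors in increasing order.
    A 2-balanced coloring never shows the pattern abab or baba, since such
    vertices form a 4-cycle with only one edge in one of the two directions.
    Hence the part that misses the least color occupies exactly an interval of
    colors, starting after the first one; conversely every such coloring is
    2-balanced. For a fixed part and a fixed color interval whose weight is the
    size of that part, the colorings with fibre sizes alpha are counted by a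
    product of two multinomial coefficients, i.e. by m! n! / alpha!. *)

Require Import Defs.
From mathcomp Require Import all_boot all_order all_algebra finmap.
From mathcomp Require Import boolp classical_sets functions cardinality fsbigop.
From mathcomp.multinomials Require Import monalg.
From mathcomp Require Import zify.

Set Implicit Arguments.
Unset Strict Implicit.
Unset Printing Implicit Defensive.

Import GRing.Theory Num.Theory.

(** * Color order, adjacency in K_{m,n} and counting along cycles *)

Lemma posint_lt_trans : transitive posint_lt.
Proof. by move=> a b c; exact: ltn_trans. Qed.

Lemma posint_lt_irr : irreflexive posint_lt.
Proof. by move=> a; exact: ltnn. Qed.

Lemma bipartite_adjE m n (u v : 'I_m + 'I_n) :
  complete_bipartite m n u v = (is_inl u != is_inl v).
Proof. by case: u v => [i|i] [j|j]. Qed.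

(** [next c] permutes the entries of [c], with inverse [prev c]. An edge of a cycle can therefore be
    charged to its end as well as to its start. *)
Lemma count_next (T : eqType) (P : pred T) (c : seq T) :
  uniq c -> count (fun v => P (next c v)) c = count P c.
Proof.
move=> uc; rewrite -(count_map (next c) P); apply/permP.
have inj : uniq (map (next c) c).
  by rewrite map_inj_uniq //; exact: can_inj (prev_next uc).
apply: uniq_perm => // x; apply/mapP/idP => [[y yc ->]|xc]; first by rewrite mem_next.
by exists (prev c x); rewrite ?mem_prev ?next_prev.
Qed.

Lemma leq_count_add (T : eqType) (P Q R : pred T) (c : seq T) :
  {in c, forall x, P x + Q x <= R x} -> count P c + count Q c <= count R c.
Proof.
elim: c => //= x c IH PQ.
have := PQ x (mem_head x c).
have : count P c + count Q c <= count R c.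
  by apply: IH => y yc; apply: PQ; rewrite inE yc orbT.
lia.
Qed.

(** * 2-balanced colorings of K_{m,n} and intervals of colors *)

Section BipartiteBalanced.
Variables (m n l : nat) (s : l.-tuple posint).
Hypothesis s_sorted : sorted posint_lt s.
Implicit Type f : {ffun 'I_m + 'I_n -> 'I_l}.

(** Encoding a coloring by the positions of its colors in [s] leaves a finite set of functions [f]
    to count. *)
Definition recolor f : {ffun 'I_m + 'I_n -> posint} := [ffun x => tnth s (f x)].

(* [i] and [j] number the colors from 1, as in [block_count]; a color
   [t : 'I_l] counts from 0. [b = true] stands for the part of size m. *)
Definition occupies f (b : bool) (i j : nat) : bool :=
  [forall x, (i <= (f x).+1 <= j) == (is_inl x == b)].

Lemma posint_lt_tnth (i j : 'I_l) : posint_lt (tnth s i) (tnth s j) = (i < j).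
Proof.
have lt (a b : 'I_l) : a < b -> posint_lt (tnth s a) (tnth s b).
  move=> ab; have d := tnth s a; rewrite !(tnth_nth d).
  by apply: (sorted_ltn_nth posint_lt_trans); rewrite ?inE ?size_tuple.
case: (ltngtP i j) => [/lt//|/lt|/val_inj->]; rewrite /posint_lt ?ltnn //.
by case: ltngtP.
Qed.

Lemma tnth_posint_inj : injective (tnth s).
Proof.
move=> i j eqs; apply/val_inj.
have := posint_lt_tnth i j; have := posint_lt_tnth j i.
by rewrite eqs /posint_lt ltnn; case: ltngtP.
Qed.

Lemma recolor_proper f :
  (forall u v, is_inl u != is_inl v -> f u != f v) ->
  proper_coloring (complete_bipartite m n) (recolor f).
Proof.
by move=> fP u v; rewrite bipartite_adjE !ffunE (inj_eq tnth_posint_inj); exact: fP.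
Qed.

Lemma induced_recolor f u v :
  induced_orientation (complete_bipartite m n) (recolor f) u v =
  (is_inl u != is_inl v) && (f u < f v).
Proof. by rewrite /induced_orientation bipartite_adjE !ffunE posint_lt_tnth. Qed.

(* Every vertex of the side whose colors avoid [i, j] lies either below or
   above all its neighbors, so on a cycle it carries one forward and one
   backward edge. *)
Lemma occupies_balanced f b i j : occupies f b i j ->
  balanced_coloring (complete_bipartite m n) 2 (recolor f).
Proof.
move=> /forallP occ.
have {}occ x : (i <= (f x).+1 <= j) = (is_inl x == b) by apply/eqP.
have fP : proper_coloring (complete_bipartite m n) (recolor f).
  apply: recolor_proper => u v uv; apply: contra uv => /eqP fuv.
  have := occ u; rewrite fuv occ.
  by case: (is_inl u); case: (is_inl v); case: b {occ}.
split=> //; split; first exact: induced_orientationP.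
move=> c /and3P[c2 cyc uc].
pose low x := (is_inl x != b) && ((f x).+1 < i).
pose high x := (is_inl x != b) && (j < (f x).+1).
(* A low end is below, and a high end above, its neighbor on side [b]. The two terms exclude each
   other, since exactly one end of an edge avoids side [b]. *)
have edge_leq (x y : bool) p q : (i <= p <= j) = (x == b) ->
    (i <= q <= j) = (y == b) -> x != y ->
    ((x != b) && (p < i)) + ((y != b) && (j < q)) <= (x != y) && (p < q).
  by case: x; case: y; case: b {occ low high}; do ?[move=> _ _ []]; rewrite ?eqxx /=; lia.
have adjn v : v \in c -> is_inl v != is_inl (next c v).
  by move=> vc; rewrite -bipartite_adjE; exact: next_cycle.
(* Sides alternate along the cycle, so it has even length, at least 4, and half of its vertices
   avoid side [b]. *)
have two : 2 <= count (fun x => is_inl x != b) c.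
  have e : count (fun x => is_inl x == b) c = count (fun x => is_inl x != b) c.
    rewrite -[RHS](@count_next _ (fun x => is_inl x != b)) //; apply: eq_in_count => v /adjn.
    by case: (is_inl v); case: (is_inl _); case: b {occ low high edge_leq}.
  have := count_predC (fun x => is_inl x == b) c.
  rewrite e -[count (predC _) c]/(count (fun x => is_inl x != b) c) addnn => szc.
  by move: c2; rewrite -szc; case: (count _ c) => [|[]].
have lowhigh : count (fun x => is_inl x != b) c <= count low c + count high c.
  have <- : count (predU low high) c = count (fun x => is_inl x != b) c.
    apply: eq_count => x; rewrite /= /low /high.
    by have := occ x; case: eqP => //= _; lia.
  by rewrite -count_predUI leq_addr.
split; apply: (leq_trans two); apply: (leq_trans lowhigh).
  (* For forward edges, a low vertex is charged to the edge after it and a high vertex to the edge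
     before it; for backward edges it is the other way round. *)
  rewrite -(count_next high uc); apply: leq_count_add => v /adjn.
  by rewrite induced_recolor -ltnS => vn; exact: edge_leq (occ v) (occ _) vn.
rewrite -(count_next low uc) addnC; apply: leq_count_add => v /adjn.
rewrite induced_recolor -ltnS addnC eq_sym => vn; exact: edge_leq (occ _) (occ v) vn.
Qed.

(** On the 4-cycle u1, v1, u2, v2 the colors rise three times, so only the closing edge is
    backward. *)
Lemma balanced_no_alternation f u1 v1 u2 v2 :
  balanced_coloring (complete_bipartite m n) 2 (recolor f) ->
  is_inl u1 = is_inl u2 -> is_inl v1 = is_inl v2 -> is_inl u1 != is_inl v1 ->
  f u1 < f v1 -> f v1 < f u2 -> f u2 < f v2 -> False.
Proof.
move=> [_ [_ bal]] uu vv uv lt1 lt2 lt3.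
pose c := [:: u1; v1; u2; v2].
have neq x y : f x < f y -> (x == y) = false.
  by move=> lt; apply/negP => /eqP e; rewrite e ltnn in lt.
have [n12 n13 n14] : [/\ (u1 == v1) = false, (u1 == u2) = false & (u1 == v2) = false].
  by split; apply: neq; lia.
have [n23 n24 n34] : [/\ (v1 == u2) = false, (v1 == v2) = false & (u2 == v2) = false].
  by split; apply: neq; lia.
have cyc : is_cycle (complete_bipartite m n) c.
  apply/and3P; split => //.
    have adjE u v : is_inl u != is_inl v -> bipartite_adj u v by rewrite -bipartite_adjE.
    by rewrite /= !adjE // -?uu -?vv // eq_sym.
  by rewrite /= !inE n12 n13 n14 n23 n24 n34.
have [_] := bal c cyc.
rewrite /backward_edges /= ?eqxx ?(eq_sym v1) ?(eq_sym u2) ?(eq_sym v2).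
rewrite ?n12 ?n13 ?n14 ?n23 ?n24 ?n34 ?eqxx !induced_recolor.
lia.
Qed.

(** Take [b] opposite to a vertex [x1] of least color, and the interval from the least to the
    greatest color on side [b]. It starts after the color of [x1], hence after the first color. *)
Lemma balanced_occupies f :
  0 < m -> 0 < n ->
  balanced_coloring (complete_bipartite m n) 2 (recolor f) ->
  exists b (p : 'I_l.+1 * 'I_l.+1), (1 < p.1 <= p.2) && occupies f b p.1 p.2.
Proof.
move=> m0 n0 bal.
have fP u v : is_inl u != is_inl v -> f u <> f v :> nat.
  move=> uv /val_inj fuv; have := bal.1 u v; rewrite bipartite_adjE => /(_ uv).
  by rewrite !ffunE fuv eqxx.
pose x0 : 'I_m + 'I_n := inl (Ordinal m0).
pose x1 := [arg min_(x < x0) f x]%N.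
have x1_min x : f x1 <= f x by rewrite /x1; case: arg_minnP => // y _; exact.
pose b := ~~ is_inl x1.
have [y0 y0b] : exists y : 'I_m + 'I_n, is_inl y == b.
  by rewrite /b; case: (is_inl x1); [exists (inr (Ordinal n0))|exists (inl (Ordinal m0))].
pose y1 := [arg min_(y < y0 | is_inl y == b) f y]%N.
pose y2 := [arg max_(y > y0 | is_inl y == b) f y]%N.
have [y1b y1_min] : is_inl y1 = b /\ forall y, is_inl y == b -> f y1 <= f y.
  by rewrite /y1; case: arg_minnP => // y /eqP.
have [y2b y2_max] : is_inl y2 = b /\ forall y, is_inl y == b -> f y <= f y2.
  by rewrite /y2; case: arg_maxnP => // y /eqP.
have lt01 : f x1 < f y1.
  by rewrite ltn_neqAle x1_min andbT; apply/eqP/fP; rewrite y1b /b; case: is_inl.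
(* [lift ord0] adds 1, passing from positions counted from 0 to colors numbered from 1. *)
exists b, (lift ord0 (f y1), lift ord0 (f y2)); rewrite /= /bump /= !add1n.
apply/andP; split; first by rewrite !ltnS (leq_ltn_trans _ lt01) //= y1_min ?y2b.
apply/forallP => x; rewrite !ltnS; apply/eqP; apply/idP/eqP => [/andP[le1 le2]|xb]; last first.
  by rewrite y1_min ?xb ?eqxx ?y2_max ?xb.
apply/eqP/negPn/negP => xb.
(* A vertex [x] of the other side inside the interval would complete the forbidden pattern. *)
apply: (balanced_no_alternation (u1 := x1) (v1 := y1) (u2 := x) (v2 := y2) bal) => //.
- by move: xb; rewrite /b; do 2!case: is_inl.
- by rewrite y1b y2b.
- by rewrite y1b /b; case: is_inl.
- rewrite ltn_neqAle le1 andbT; apply/eqP/fP.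
  by rewrite y1b eq_sym.
rewrite ltn_neqAle le2 andbT; apply/eqP/fP.
by rewrite y2b.
Qed.

(** Both intervals miss the first color, which is used, so the side of its vertices determines [b]
    and [b']. As every color is used, the two intervals then contain the same colors. *)
Lemma occupies_inj f b b' (p p' : 'I_l.+1 * 'I_l.+1) :
  (forall t, exists x, f x = t) ->
  1 < p.1 <= p.2 -> 1 < p'.1 <= p'.2 ->
  occupies f b p.1 p.2 -> occupies f b' p'.1 p'.2 -> b = b' /\ p = p'.
Proof.
clear s s_sorted => surj; case: p => i j; case: p' => i' j' /= ij ij'.
move=> /forallP occ /forallP occ'.
have l0 : 0 < l by have := ltn_ord i; lia.
have [x0 fx0] := surj (Ordinal l0).
have bb : b = b'.
  have := occ x0; have := occ' x0; rewrite fx0 /=.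
  by case: is_inl; case: b {occ}; case: b' {occ'}; lia.
split=> //.
have E (t : 'I_l) : (i <= t.+1 <= j) = (i' <= t.+1 <= j').
  by have [x <-] := surj t; rewrite (eqP (occ x)) (eqP (occ' x)) bb.
have Ek k : 0 < k -> k <= l -> (i <= k <= j) = (i' <= k <= j').
  by case: k => // k _ kl; exact: (E (Ordinal kl)).
(* Each endpoint lies in its own interval, hence in the other one. *)
have := Ek i; have := Ek i'; have := Ek j; have := Ek j'.
move: (ltn_ord i) (ltn_ord i') (ltn_ord j) (ltn_ord j') => *.
by congr (_, _); apply: val_inj => /=; lia.
Qed.

End BipartiteBalanced.

(** * Counting functions with prescribed fibre sizes *)

Lemma sum_tuple_cons (I : finType) (k : nat) (F : k.+1.-tuple I -> nat) :
  \sum_(t : k.+1.-tuple I) F t =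
  \sum_(x : I) \sum_(t : k.-tuple I) F (cons_tuple x t).
Proof.
rewrite pair_big /=.
rewrite (reindex (fun p : I * k.-tuple I => cons_tuple p.1 p.2)) //=.
exists (fun t : k.+1.-tuple I => (thead t, behead_tuple t)) => [[x t] _|t _] /=.
  by rewrite theadE; congr (_, _); exact: val_inj.
by rewrite [RHS]tuple_eta; exact: val_inj.
Qed.

(** List form of the functions to be counted, which allows induction on the first letter. *)
Definition words (I J : finType) (sigma : I -> J) (rho : seq J) (beta : I -> nat) :=
  [pred t : (size rho).-tuple I |
    (map sigma t == rho) && [forall i, count_mem i t == beta i]].

(* A word with first letter i0 contributes, after removing that letter and
   multiplying by the factorials, a factor [beta i0]; these factors add up to
   the multiplicity of the first letter of [rho]. *)
Lemma card_words (I J : finType) (sigma : I -> J) (rho : seq J) (beta : I -> nat) :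
  (forall j, \sum_(i | sigma i == j) beta i = count_mem j rho) ->
  #|words sigma rho beta| * \prod_i (beta i)`! = \prod_j (count_mem j rho)`!.
Proof.
elim: rho beta => [|j rho IH] beta beta_rho.
  have beta0 i : beta i = 0.
    by have /eqP := beta_rho (sigma i); rewrite (bigD1 i) //= addn_eq0 => /andP[/eqP].
  rewrite !big1 ?muln1 // => [|i _]; last by rewrite beta0.
  rewrite (eq_card (B := predT)) ?card_tuple ?expn0 // => t.
  rewrite !inE tuple0 /=; apply/forallP => i.
  by rewrite beta0.
(* Multiplicities left once the first letter [i0] is removed; [0 < beta i0] keeps the subtraction
   from truncating. *)
pose pred_beta i0 i := beta i - (i == i0).
have cardE : #|words sigma (j :: rho) beta| =
    \sum_(i0 | (sigma i0 == j) && (0 < beta i0)) #|words sigma rho (pred_beta i0)|.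
  rewrite -sum1_card big_mkcond /= sum_tuple_cons [RHS]big_mkcond /=.
  apply: eq_bigr => i0 _; case: ifPn => [/andP[/eqP si0 b0]|nb].
    rewrite -sum1_card [RHS]big_mkcond /=; apply: eq_bigr => t _.
    rewrite !inE /= si0 eqseq_cons eqxx /=; congr (if _ && _ then _ else _).
    apply: eq_forallb => i; rewrite /pred_beta.
    by have [<-|] := eqVneq i0 i; lia.
  apply: big1 => t _; case: ifPn => //; rewrite inE /= eqseq_cons => /andP[/andP[si0 _]].
  move=> /forallP /(_ i0); rewrite eqxx /= => /eqP bi0.
  by case/negP: nb; rewrite si0 -bi0.
rewrite cardE big_distrl /=.
pose P := \prod_j (count_mem j rho)`!.
have step i0 : sigma i0 == j -> 0 < beta i0 ->
    #|words sigma rho (pred_beta i0)| * \prod_i (beta i)`! = beta i0 * P.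
  have pred_betaE : pred_beta i0 i0 = (beta i0).-1 by rewrite /pred_beta eqxx subn1.
  move=> si0 b0; rewrite /P -(IH (pred_beta i0)) => [|j'].
    rewrite (bigD1 i0) //= [in RHS](bigD1 i0) //=.
    rewrite [in RHS](eq_bigr (fun i => (beta i)`!)) => [|i /negPf ii0]; last first.
      by rewrite /pred_beta ii0 subn0.
    rewrite pred_betaE -[in LHS](prednK b0) factS (prednK b0).
    by rewrite -mulnA mulnCA.
  have := beta_rho j'; rewrite /=.
  have [<-|nj] := eqVneq j j'.
    rewrite (bigD1 i0) //= add1n => E; rewrite (bigD1 i0) //=.
    apply: succn_inj; rewrite -E -addSn.
    rewrite pred_betaE prednK //; congr addn; apply: eq_bigr => i /andP[_ /negPf ii0].
    by rewrite /pred_beta ii0 subn0.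
  rewrite add0n => <-; apply: eq_bigr => i /eqP sij.
  rewrite /pred_beta; case: eqVneq => [ii0|]; last by rewrite subn0.
  by move: si0 nj; rewrite -sij ii0 eq_sym => ->.
rewrite (eq_bigr (fun i0 => beta i0 * P)) => [|i0 /andP[]]; last exact: step.
rewrite -big_distrl /= (bigD1 j) //= eqxx add1n factS -mulnA.
rewrite (_ : \sum_(i | _) beta i = (count_mem j rho).+1); last first.
  have := beta_rho j; rewrite /= eqxx add1n => <-.
  by rewrite [RHS]big_mkcond [LHS]big_mkcond /=; apply: eq_bigr => i _; do ?case: ifP; lia.
congr muln; rewrite /P (bigD1 j) //=; congr muln.
by apply: eq_bigr => j' /negPf; rewrite eq_sym => ->.
Qed.

(** Each class [j] contributes the multinomial coefficient of the [beta i] with [sigma i = j];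
    denominators are cleared. Listing values along [enum T] reduces this to words. *)
Lemma card_fibre_profile (T I J : finType) (rho : T -> J) (sigma : I -> J) (beta : I -> nat) :
  (forall j, \sum_(i | sigma i == j) beta i = #|[pred x | rho x == j]|) ->
  #|[pred f : {ffun T -> I} | [forall x, sigma (f x) == rho x] &&
      [forall i, #|[pred x | f x == i]| == beta i]]| * \prod_i (beta i)`! =
  \prod_j (#|[pred x | rho x == j]|)`!.
Proof.
move=> beta_rho.
have cnt (K : eqType) (g : T -> K) k :
    count_mem k (map g (enum T)) = #|[pred x | g x == k]|.
  by rewrite count_map enumT -size_filter cardE.
transitivity (\prod_j (count_mem j (map rho (enum T)))`!); last first.
  by apply: eq_bigr => j _; rewrite cnt.
rewrite -(@card_words I J sigma _ beta) => [|j]; last by rewrite cnt.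
congr muln.
have sz : size (map rho (enum T)) = #|T| by rewrite size_map cardE.
pose F (f : {ffun T -> I}) : (size (map rho (enum T))).-tuple I :=
  tcast (esym sz) (fgraph f).
have F_inj : injective F.
  move=> f g /(congr1 val); rewrite /= !val_tcast => fg.
  by apply: (can_inj fgraphK); exact: val_inj.
rewrite -(fintype.card_image F_inj); apply: eq_card => t.
apply/fintype.imageP/idP => [[f]|].
  rewrite inE => /andP[/forallP sf /forallP bf] ->.
  rewrite inE val_tcast /= (_ : tval (fgraph f) = map f (enum T)); last first.
    by rewrite -[RHS]/(codom f) codom_ffun.
  rewrite -map_comp.
  apply/andP; split.
    by apply/eqP/eq_map => x; exact/eqP/sf.
  by apply/forallP => i; rewrite cnt.
rewrite inE => /andP[st /forallP bt].
exists (Finfun (tcast sz t)); last by rewrite /F FinfunK tcastK.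
have E : codom (Finfun (tcast sz t)) = t by rewrite codom_ffun FinfunK val_tcast.
rewrite inE; apply/andP; split.
  move: st; rewrite -E /codom /image_mem -map_comp => /eqP/eq_in_map st.
  by apply/forallP => x; apply/eqP/st; rewrite mem_enum.
apply/forallP => i; have := bt i.
by rewrite -E cnt.
Qed.

(** * Counting 2-balanced colorings with fibre sizes [alpha] *)

Section ColoringCount.
Variables (m n : nat) (alpha : seq nat).
Local Notation l := (size alpha).
Implicit Type f : {ffun 'I_m + 'I_n -> 'I_l}.

Definition has_profile f : bool :=
  [forall t, #|[pred x | f x == t]| == nth 0 alpha t].

Lemma sumn_profile f : has_profile f -> sumn alpha = m + n.
Proof.
move=> /forallP prof; rewrite sumnE (big_nth 0) big_mkord.
transitivity #|{: 'I_m + 'I_n}|; last by rewrite card_sum !card_ord.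
rewrite -sum1_card (partition_big f predT) //=; apply: eq_bigr => t _.
by rewrite -(eqP (prof t)) -sum1_card.
Qed.

Lemma card_side (b : bool) :
  #|[pred x : 'I_m + 'I_n | is_inl x == b]| = if b then m else n.
Proof.
rewrite -sum1_card big_sumType /=.
rewrite (eq_bigl (fun _ => b)) => [|i]; last by rewrite inE /=; case: b.
rewrite [X in _ + X](eq_bigl (fun _ => ~~ b)) => [|i]; last by rewrite inE /=; case: b.
by case: b; rewrite big_pred0_eq ?addn0 ?add0n sum1_card card_ord.
Qed.

(** Parts are numbered from 1 and positions from 0; [0 < i] prevents [t.-1] from hitting the first
    part twice. *)
Lemma part_sumE i j : 0 < i -> j <= l ->
  part_sum alpha i j = \sum_(t < l | i <= t.+1 <= j) nth 0 alpha t.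
Proof.
move=> i0 jl; rewrite /part_sum -(prednK i0) big_add1 /=.
rewrite (big_nat_widen _ _ l) //= big_geq_mkord /=.
by apply: eq_bigl => t; rewrite andbC.
Qed.

(** Two classes are matched: side [b] with the colors in the interval, the other side with the
    remaining colors. This yields two multinomial coefficients, or nothing if the interval has the
    wrong weight. *)
Lemma card_occupies b i j : 0 < i -> j <= l -> sumn alpha = m + n ->
  #|[pred f | has_profile f && occupies f b i j]| * comp_fact alpha =
  (part_sum alpha i j == if b then m else n) * (m`! * n`!).
Proof.
move=> i0 jl sum_alpha.
have sideN : #|[pred x : 'I_m + 'I_n | (is_inl x == b) == false]| = if b then n else m.
  transitivity (if ~~ b then m else n); last by case: b.
  by rewrite -card_side; apply: eq_card => x; rewrite !inE; case: is_inl; case: b.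
have sideT : #|[pred x : 'I_m + 'I_n | (is_inl x == b) == true]| = if b then m else n.
  by rewrite -card_side; apply: eq_card => x; rewrite !inE eqb_id.
have [ps|ps] := eqVneq; last first.
  rewrite mul0n (eq_card0 (A := _)) // => f; rewrite !inE.
  apply/negP => /andP[/forallP prof /forallP occ]; case/eqP: ps.
  (* The vertices with colors in an occupied interval are exactly those of side [b], so counting
     them fibre by fibre gives the forbidden equality. *)
  rewrite part_sumE // -card_side -sum1_card.
  rewrite (partition_big f (fun t : 'I_l => i <= t.+1 <= j)) /= => [|x]; last first.
    by rewrite inE -(eqP (occ x)).
  apply: eq_bigr => t tij; rewrite -(eqP (prof t)) -sum1_card; apply: eq_bigl => x.
  rewrite !inE -(eqP (occ x)); case: eqP => [->|]; last by rewrite andbF.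
  by rewrite tij.
have sum_all : \sum_(t < l) nth 0 alpha t = m + n.
  by rewrite -sum_alpha sumnE (big_nth 0) big_mkord.
pose sigma (t : 'I_l) := i <= t.+1 <= j.
have := @card_fibre_profile ('I_m + 'I_n)%type 'I_l bool
  (fun x => is_inl x == b) sigma (nth 0 alpha).
rewrite big_bool sideN sideT /comp_fact (big_nth 0) big_mkord /=.
have -> : (if b then m else n)`! * (if b then n else m)`! = m`! * n`!.
  by case: b {ps sideN sideT} => //; rewrite mulnC.
rewrite mul1n => <- => [|c].
  by congr muln; apply: eq_card => f; rewrite !inE andbC.
have sum_in : \sum_(t < l | sigma t) nth 0 alpha t = if b then m else n.
  by rewrite -ps part_sumE.
case: c; [rewrite sideT -sum_in|rewrite sideN].
  by apply: eq_bigl => t; rewrite eqb_id.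
(* The parts outside the interval make up the size of the other side. *)
move: sum_all; rewrite (bigID sigma) /= sum_in => sum_all.
transitivity (\sum_(t < l | ~~ sigma t) nth 0 alpha t).
  by apply: eq_bigl => t; rewrite eqbF_neg.
by case: b {ps sideN sideT sum_in} sum_all => E;
  [apply: (@addnI m)|apply: (@addnI n)]; rewrite E // addnC.
Qed.

(** Each summand now matches one instance of [card_occupies]; for m = n an interval still counts
    once per side. *)
Lemma rE :
  r alpha m n = \sum_(b : bool) \sum_(p : 'I_l.+1 * 'I_l.+1 | 1 < p.1 <= p.2)
    (part_sum alpha p.1 p.2 == if b then m else n).
Proof.
have cnt k : block_count alpha (pred1 k) =
    \sum_(p : 'I_l.+1 * 'I_l.+1 | 1 < p.1 <= p.2) (part_sum alpha p.1 p.2 == k).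
  by rewrite /block_count -sum1_card big_mkcondr /=; apply: eq_bigr => p _; case: eqP.
by rewrite big_bool /r !cnt.
Qed.

Lemma has_profile_surj f : all (fun a => 0 < a) alpha -> has_profile f ->
  forall t, exists x, f x = t.
Proof.
move=> /all_nthP alpha0 /forallP prof t.
have /card_gt0P[x] : 0 < #|[pred x | f x == t]| by rewrite (eqP (prof t)) alpha0.
by rewrite inE => /eqP; exists x.
Qed.

(** A 2-balanced coloring with this profile has exactly one occupied pair of side and interval, and
    other colorings have none. Summing over these pairs first reduces the count to
    [card_occupies]. *)
Lemma card_balanced (s : l.-tuple posint) : 0 < m -> 0 < n ->
  sorted posint_lt s -> composition (m + n) alpha ->
  #|[pred f | has_profile f &&
      `[< balanced_coloring (complete_bipartite m n) 2 (recolor s f) >]]| *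
    comp_fact alpha = m`! * n`! * r alpha m n.
Proof.
move=> m0 n0 ss /andP[alpha0 /eqP sum_alpha].
rewrite rE big_distrr /= -sum1_card big_mkcond /= big_distrl /=.
transitivity (\sum_f (\sum_(b : bool) \sum_(p : 'I_l.+1 * 'I_l.+1 | 1 < p.1 <= p.2)
    (has_profile f && occupies f b p.1 p.2)) * comp_fact alpha).
  apply: eq_bigr => f _; congr muln; rewrite inE.
  rewrite pair_big_dep /=.
  have [prof|_] /= := boolP (has_profile f); last by rewrite big1.
  have surj := has_profile_surj alpha0 prof.
  case: asboolP => [bal|nbal].
    have [b [p /andP[vp occ]]] := balanced_occupies ss m0 n0 bal.
    rewrite (bigD1 (b, p)) //= occ big1 // => -[b' p'] /= /andP[vp'].
    case: (boolP (occupies _ _ _ _)) => // occ'.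
    have [-> ->] := occupies_inj surj vp vp' occ occ'.
    by rewrite eqxx.
  symmetry; apply: big1 => -[b p] _ /=; apply/eqP; rewrite eqb0; apply/negP => occ.
  exact/nbal/(occupies_balanced ss occ).
rewrite -big_distrl /= exchange_big /= big_distrl /=; apply: eq_bigr => b _.
rewrite exchange_big /= big_distrl big_distrr /=; apply: eq_bigr => p /andP[p1 p2].
rewrite [RHS]mulnC -card_occupies //; [|lia|by rewrite -ltnS].
by congr muln; rewrite -sum1_card [RHS]big_mkcond.
Qed.

End ColoringCount.

(** * Coefficients of the series at a given monomial *)

Section MonomialCoefficients.
Implicit Types (w : monomial) (c : posint) (alpha : seq nat).

Lemma coef_prod (I : Type) (e : seq I) (F : I -> monomial) c :
  (\big[mmul/mone]_(i <- e) F i : monomial) c = \sum_(i <- e) F i c.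
Proof. exact: (big_morph (fun w : monomial => w c) (fun w1 w2 => cmM c w1 w2) (cm1 c)). Qed.

Lemma coef_expcmn w k c : expcmn w k c = k * w c.
Proof.
rewrite /expcmn; case: k => [|k]; first by rewrite /= onecmE.
by elim: k => [|k IH]; rewrite ?mul1n // [LHS]mulcmE mulSn -IH.
Qed.

Lemma coef_coloring_monomial (V : finType) (kappa : {ffun V -> posint}) c :
  coloring_monomial kappa c = #|[pred v | kappa v == c]|.
Proof.
rewrite /coloring_monomial coef_prod -sum1_card [RHS]big_mkcond /=.
by apply: eq_bigr => v _; rewrite /xvar ucmE inE; case: eqP.
Qed.

Lemma coef_index_monomial alpha (i : (size alpha).-tuple posint) c :
  index_monomial i c = \sum_(t < size alpha | tnth i t == c) nth 0 alpha t.
Proof.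
rewrite /index_monomial coef_prod [RHS]big_mkcond /=; apply: eq_bigr => t _.
by rewrite coef_expcmn /xvar ucmE; case: eqP => _; rewrite ?muln1 ?muln0.
Qed.

Definition support_colors w : seq posint := sort (relpre val leq) (finsupp w).

(** The one list [alpha] of positive parts for which [w] occurs in [monomial_qsym alpha]. *)
Definition exponents w : seq nat := map w (support_colors w).

Lemma mem_support_colors w c : (c \in support_colors w) = (0 < w c).
Proof. by rewrite mem_sort lt0n cmE_neq0. Qed.

Lemma sorted_support_colors w : sorted posint_lt (support_colors w).
Proof.
rewrite -[sorted _ _]/(sorted (relpre val ltn) _) -sorted_map ltn_sorted_uniq_leq.
rewrite (map_inj_uniq val_inj) sort_uniq fset_uniq sorted_map /=.
by apply: sort_sorted => a b; exact: leq_total.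
Qed.

Lemma size_support_colors w : size (support_colors w) == size (exponents w).
Proof. by rewrite size_map. Qed.

Definition color_tuple w : (size (exponents w)).-tuple posint :=
  Tuple (size_support_colors w).

Lemma coef_color_tuple w t : w (tnth (color_tuple w) t) = nth 0 (exponents w) t.
Proof.
rewrite (tnth_nth (tnth (color_tuple w) t)) /exponents (nth_map (tnth (color_tuple w) t)) //.
by have := ltn_ord t; rewrite [X in _ < X -> _]size_map.
Qed.

Lemma all_exponents w : all (fun a => 0 < a) (exponents w).
Proof.
by apply/allP => a /mapP[c + ->]; rewrite mem_support_colors.
Qed.

Lemma index_monomial_tnth alpha (i : (size alpha).-tuple posint) t :
  sorted posint_lt i -> index_monomial i (tnth i t) = nth 0 alpha t.
Proof.
move=> si; rewrite coef_index_monomial (big_pred1 t) // => u.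
by rewrite /= (inj_eq (tnth_posint_inj si)).
Qed.

Lemma index_monomial_color_tuple w : index_monomial (color_tuple w) = w.
Proof.
apply/eqP/cmP => c.
have [/tnthP[t ->]|cs] := boolP (c \in color_tuple w).
  by rewrite index_monomial_tnth ?coef_color_tuple //; exact: sorted_support_colors.
rewrite coef_index_monomial big_pred0 => [|t]; last first.
  by apply: contraNF cs => /eqP<-; exact: mem_tnth.
by move: cs; rewrite mem_support_colors lt0n negbK => /eqP.
Qed.

(** Positive exponents put every index in the support, and a strictly increasing list is determined
    by its set of entries. *)
Lemma index_monomial_inv alpha (i : (size alpha).-tuple posint) :
  all (fun a => 0 < a) alpha -> sorted posint_lt i ->
  support_colors (index_monomial i) = i /\ exponents (index_monomial i) = alpha.
Proof.
move=> /all_nthP alpha0 si.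
have supp : support_colors (index_monomial i) = i.
  apply: (irr_sorted_eq posint_lt_trans posint_lt_irr) => //.
    exact: sorted_support_colors.
  move=> c; rewrite mem_support_colors; apply/idP/tnthP => [|[t ->]]; last first.
    by rewrite index_monomial_tnth // alpha0.
  have [/tnthP//|ci] := boolP (c \in i).
  rewrite coef_index_monomial big_pred0 // => t.
  by apply: contraNF ci => /eqP<-; exact: mem_tnth.
split=> //; rewrite /exponents supp.
apply: (@eq_from_nth _ 0) => [|t]; first by rewrite size_map size_tuple.
rewrite size_map size_tuple => ht.
rewrite (nth_map (tnth i (Ordinal ht))) ?size_tuple //.
by rewrite -[t]/(val (Ordinal ht)) -tnth_nth index_monomial_tnth.
Qed.

Local Open Scope classical_set_scope.
Local Open Scope ring_scope.

Lemma fps_sumE (I : Type) (e : seq I) (F : I -> fps) w :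
  (\sum_(i <- e) F i) w = \sum_(i <- e) F i w.
Proof. by elim: e => [|i e IH]; rewrite ?big_nil // !big_cons -IH. Qed.

(** Only the index tuple [color_tuple w] can produce [w], and only with the exponents of [w]. *)
Lemma coef_monomial_qsym alpha w : all (fun a => 0 < a)%N alpha ->
  monomial_qsym alpha w = (alpha == exponents w)%:R.
Proof.
move=> alpha0; rewrite /monomial_qsym /fps_sum /fps_monomial.
have [->|ne] := eqVneq alpha (exponents w); last first.
  apply: fsbig1 => i si; case: eqP => // wi.
  by move: ne; rewrite wi (index_monomial_inv alpha0 si).2 eqxx.
rewrite -(fsbig_widen [set color_tuple w]) ?fsbig_set1 /=.
- by rewrite index_monomial_color_tuple eqxx.
- by move=> _ ->; exact: sorted_support_colors.
move=> i [si ni] /=; case: eqP => // wi; case: ni.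
apply: val_inj => /=; rewrite [in RHS]wi.
by rewrite (index_monomial_inv (all_exponents w) si).1.
Qed.

(** A coloring with monomial [w] takes its colors in the support of [w], so it is
    [recolor (color_tuple w) f] for a unique [f], whose fibre sizes are the exponents of [w]. *)
Lemma coef_chromatic m n w :
  chromatic_qsym (complete_bipartite m n) 2 w =
  #|[pred f : {ffun 'I_m + 'I_n -> 'I_(size (exponents w))} | has_profile f &&
      `[< balanced_coloring (complete_bipartite m n) 2 (recolor (color_tuple w) f) >]]|%:R.
Proof.
rewrite /chromatic_qsym /fps_sum /fps_monomial.
set A := [pred f | _].
have inj := tnth_posint_inj (sorted_support_colors w : sorted posint_lt (color_tuple w)).
have coefE (f : {ffun 'I_m + 'I_n -> _}) t :
    coloring_monomial (recolor (color_tuple w) f) (tnth (color_tuple w) t) =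
    #|[pred x | f x == t]|.
  rewrite coef_coloring_monomial; apply: eq_card => x.
  by rewrite !inE ffunE (inj_eq inj).
rewrite -(fsbig_widen [set recolor (color_tuple w) f | f in [set` A]]).
- rewrite fsbig_image => [|f g _ _ /ffunP fg]; last first.
    by apply/ffunP => x; have := fg x; rewrite !ffunE; exact: inj.
  rewrite (eq_fsbigr (fun=> 1)) => [|f]; last first.
    rewrite inE /= inE => /andP[/forallP prof _].
    rewrite (_ : (_ == _) = true) //; apply/cmP => c.
    have [/tnthP[t ->]|cs] := boolP (c \in color_tuple w).
      by rewrite coefE (eqP (prof t)) coef_color_tuple.
    move: (cs); rewrite mem_support_colors -eqn0Ngt => /eqP->.
    rewrite coef_coloring_monomial eq_card0 // => x; rewrite inE ffunE.
    by apply: contraNF cs => /eqP<-; exact: mem_tnth.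
  rewrite (fsbig_fwiden (enum A)) ?enum_uniq //=.
  - by rewrite big_enum /= sumr_const.
  - by move=> f; rewrite /= mem_enum.
  by move=> f [/=]; rewrite mem_enum.
- by move=> _ [f + <-]; rewrite /= inE => /andP[_ /asboolP].
move=> kappa [bal nk] /=; case: eqP => // wk; case: nk.
(* A contributing coloring is shown to lie in the image by choosing a position for each of its
   colors. *)
have ks x : kappa x \in color_tuple w.
  by rewrite mem_support_colors wk coloring_monomial_gt0.
have /fin_all_exists[g gk] x : exists t, kappa x = tnth (color_tuple w) t by exact/tnthP/ks.
have kE : recolor (color_tuple w) (finfun g) = kappa by apply/ffunP => x; rewrite !ffunE.
exists (finfun g) => //=; rewrite inE; apply/andP; split; last by apply/asboolP; rewrite kE.
by apply/forallP => t; rewrite -coefE kE -coef_color_tuple -wk.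
Qed.

End MonomialCoefficients.

(** * Comparison of coefficients *)

Local Open Scope ring_scope.

Theorem theorem4p4 (m n : nat) (hm : (1 <= m)%N) (hn : (1 <= n)%N) :
  chromatic_qsym (complete_bipartite m n) 2 =
  \sum_(alpha \in composition (m + n)%N)
    ((m`!%:R * n`!%:R / (comp_fact alpha)%:R * (r alpha m n)%:R : rat)
       *: monomial_qsym alpha).
Proof.
apply: funext => w; rewrite coef_chromatic.
transitivity (\sum_(alpha \in composition (m + n)%N)
   (m`!%:R * n`!%:R / (comp_fact alpha)%:R * (r alpha m n)%:R *
      (alpha == exponents w)%:R : rat)); last first.
  rewrite !fsbig_finite; try exact: finite_composition.
  rewrite fps_sumE.
  apply: eq_big_seq => alpha; rewrite in_fset_set; last exact: finite_composition.
  by rewrite inE => /andP[alpha0 _]; rewrite -coef_monomial_qsym.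
have [comp_w|ncomp] := pselect (composition (m + n) (exponents w)).
  (* Only [alpha = exponents w] contributes; its coefficient is the count in [card_balanced] after
     division by [comp_fact]. *)
  rewrite -(fsbig_widen [set exponents w]%classic) ?fsbig_set1.
  - rewrite eqxx mulr1 mulrAC -!natrM.
    rewrite -(card_balanced hm hn (sorted_support_colors w : sorted _ (color_tuple w)) comp_w).
    rewrite natrM mulfK // pnatr_eq0 -lt0n.
    by rewrite /comp_fact prodn_gt0 // => a; exact: fact_gt0.
  - by move=> _ ->.
  by move=> alpha [_ /eqP/negPf] /= ->; rewrite mulr0.
(* If the exponents of [w] do not sum to m + n, no composition matches them and no [f] has them as
   fibre sizes, so both sides vanish. *)
rewrite fsbig1 => [|alpha calpha]; last first.
  by case: eqP => [e|]; [case: ncomp; rewrite -e|rewrite mulr0].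
rewrite eq_card0 // => f; rewrite inE; apply/negP => /andP[prof _].
case: ncomp; apply/andP; split; first exact: all_exponents.
by rewrite -(sumn_profile prof).
Qed.
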